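(* Let $(\mathcal{X},d_{\mathcal{X}})$ and $(\mathcal{Y},d_{\mathcal{Y}})$ be separable metric spaces of strong negative type. For any $\theta\in M_1^{1,1}(\mathcal{X}\times\mathcal{Y})$ with marginals $\mu\in M_1^1(\mathcal{X})$ and $\nu\in M_1^1(\mathcal{Y})$, it holds that $$dcov(\theta)=0\iff\theta=\mu\times\nu .$$
   Context: A metric space is of negative type if $\sum_{i,j=1}^n\alpha_i\alpha_j d(x_i,x_j)\le 0$ for all $n\in\mathbb{N}$, points $x_1,\dots,x_n$ and $\alpha\in\mathbb{R}^n$ with $\sum_i\alpha_i=0$. $M_1^1(\mathcal{X})$ is the set of Borel probability measures $\mu$ on $\mathcal{X}$ with finite first moment: $\int d_{\mathcal{X}}(x,o)\,d\mu(x)<\infty$ for some (equivalently every) $o\in\mathcal{X}$. $M^1(\mathcal{X})$ is the set of finite signed Borel measures $\mu$ with $\int d_{\mathcal{X}}(x,o)\,d|\mu|(x)<\infty$. $M_1^{1,1}(\mathcal{X}\times\mathcal{Y})$ is the set of probability measures on $\mathcal{B}(\mathcal{X})\otimes\mathcal{B}(\mathcal{Y})$ whose marginals lie in $M_1^1(\mathcal{X})$ and $M_1^1(\mathcal{Y})$. For $\mu\in M^1(\mathcal{X})$: $a_\mu(x)=\int d_{\mathcal{X}}(x,y)\,d\mu(y)$, $D(\mu)=\int a_\mu\,d\mu=\int d_{\mathcal{X}}\,d(\mu\times\mu)$, $d_\mu(x_1,x_2)=d_{\mathcal{X}}(x_1,x_2)-a_\mu(x_1)-a_\mu(x_2)+D(\mu)$,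 and analogously on $\mathcal{Y}$. A metric space $(\mathcal{X},d_{\mathcal{X}})$ of negative type is of strong negative type if for all $\mu_1,\mu_2\in M_1^1(\mathcal{X})$: $D(\mu_1-\mu_2)=0\iff\mu_1=\mu_2$. For $\theta\in M_1^{1,1}(\mathcal{X}\times\mathcal{Y})$ with marginals $\mu,\nu$, $$dcov(\theta)=\int d_\mu(x_1,x_2)\,d_\nu(y_1,y_2)\,d(\theta\times\theta)((x_1,y_1),(x_2,y_2)).$$ *)

(* Defs.v *)
From HB Require Import structures.
From mathcomp Require Import all_boot all_order all_algebra.
From mathcomp Require Import all_classical all_reals all_analysis.

Set Implicit Arguments.
Unset Strict Implicit.
Unset Printing Implicit Defensive.

Import Order.TTheory GRing.Theory Num.Theory.
Import numFieldNormedType.Exports.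

Local Open Scope classical_set_scope.
Local Open Scope ring_scope.

(* [measurableType] requires a point. A space carrying a probability measure is
   nonempty, so nothing is lost. *)
#[short(type="pointedMetricType")]
HB.structure Definition PointedMetric (R : numDomainType) :=
  {T of Metric R T & Pointed T}.

(* [X] equipped with its Borel sigma-algebra. *)
Notation borel X := (g_sigma_algebraType (@open X)).

Definition separable (X : topologicalType) : Prop :=
  exists2 S : set X, countable S & dense S.

Definition negative_type (R : realType) (X : pointedMetricType R) : Prop :=
  forall (n : nat) (x : 'I_n -> X) (alpha : 'I_n -> R),
    \sum_(i < n) alpha i = 0 ->
    \sum_(i < n) \sum_(j < n) alpha i * alpha j * mdist (x i) (x j) <= 0.

(* A library measure is a function on all sets, so equality of measures is
   equality on the measurable ones. *)
Definition measure_eq d (T : measurableType d) (R : realType)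
    (mu nu : {measure set T -> \bar R}) : Prop :=
  forall A, measurable A -> mu A = nu A.

Section charge_integral.
Context d (T : measurableType d) (R : realType).
Variable mu : {charge set T -> \bar R}.

Definition hahn_pair : {PN : set T * set T | hahn_decomposition mu PN.1 PN.2}.
Proof.
by apply: cid; have [P [N muPN]] := Hahn_decomposition mu; exists (P, N).
Defined.

(* Integral against a finite signed measure, through its Jordan decomposition
   (which does not depend on the chosen Hahn decomposition). *)
Definition charge_integral (f : T -> R) : R :=
  \int[jordan_pos (svalP hahn_pair)]_x f x -
  \int[jordan_neg (svalP hahn_pair)]_x f x.

End charge_integral.

Section signed_measures.
Context (R : realType) (X : pointedMetricType R).
Implicit Type mu : {charge set (borel X) -> \bar R}.

(* The integrals below are real-valued: they converge absolutely as soon as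
   [mu] has a finite first moment. *)
Definition dist_mean mu (x : X) : R :=
  charge_integral mu (fun y : borel X => mdist x (y : X)).

Definition dist_energy mu : R := charge_integral mu (dist_mean mu).

Definition centered_dist mu (x1 x2 : X) : R :=
  mdist x1 x2 - dist_mean mu x1 - dist_mean mu x2 + dist_energy mu.

End signed_measures.

Definition finite_first_moment (R : realType) (X : pointedMetricType R)
    (mu : probability (borel X) R) : Prop :=
  exists o : X, (\int[mu]_x (mdist (x : X) o)%:E < +oo)%E.

Definition strong_negative_type (R : realType) (X : pointedMetricType R) : Prop :=
  negative_type X /\
  forall mu1 mu2 : probability (borel X) R,
    finite_first_moment mu1 -> finite_first_moment mu2 ->
    dist_energy (cadd (charge_of_finite_measure mu1)
                      (copp (charge_of_finite_measure mu2))) = 0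
    <-> measure_eq mu1 mu2.

Section product_space.
Context (R : realType) (X Y : pointedMetricType R).
Variable theta : probability (borel X * borel Y)%type R.

Definition marginal1 : probability (borel X) R :=
  distribution theta (mfun_Sub (mem_set measurable_fst)).
Definition marginal2 : probability (borel Y) R :=
  distribution theta (mfun_Sub (mem_set measurable_snd)).

Definition finite_first_moments : Prop :=
  finite_first_moment marginal1 /\ finite_first_moment marginal2.

Definition dcov : R :=
  \int[(theta \x theta)%E]_z
    (centered_dist (charge_of_finite_measure marginal1) z.1.1 z.2.1 *
     centered_dist (charge_of_finite_measure marginal2) z.1.2 z.2.2).

End product_space.

(* Main.v *)
Require Import Defs.
From HB Require Import structures.
From mathcomp Require Import all_boot all_order all_algebra.
From mathcomp Require Import all_classical all_reals all_analysis.
From mathcomp Require Import measurable_realfun ring lra.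

(** For a law [mu] on a metric space, let a(x) be the mean distance from x to a
    [mu]-random point, and let c be the centered distance [cdist mu], that is
    c(x, y) = d(x, y) - a(x) - a(y) + D. If [theta] has marginals [mu] and [nu],
    its distance covariance is the double integral against [theta] of the kernel
    k((x, y), (x', y')) = c_mu(x, x') c_nu(y, y').

    Negative type makes - c_mu and - c_nu positive semidefinite
    ([cdist_psd]), so k is positive semidefinite by Schur's product theorem
    ([schur_product]). Hence the quadratic form defined by k is nonnegative at
    [theta] plus a point mass t at v, for every real t ([psd_integral]). When
    dcov(theta) = 0 this quadratic polynomial in t has no constant term, and being
    nonnegative it has no linear term either: k(., v) has [theta]-integral 0 for
    every point v ([dcov0_kernel]).

    Strong negative type then strips off the two factors of k one at a time
    ([strong_negative_type_cdist]). Fix y. The image on X of the signed measure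
    c_nu(., y) theta has total mass 0, and c_mu(., x) has integral 0 against it
    for every x; so d(., x) has an integral independent of x, the energy of this
    measure is 0, and the measure vanishes. This means that, for every Borel set
    B of X, the function c_nu(., y) has integral 0 against the image on Y of
    (1_B - mu(B)) theta, and the same argument on Y shows that this image
    vanishes too. So theta(B x C) = mu(B) nu(C) for all Borel sets B and C.

    Only first moments are available, and one inequality makes them suffice:
    |c(x, y)| <= 2 min(a(x), a(y)), from the triangle inequality
    ([cdist_boundr], [cdist_boundl]). It shows that c_nu(., y) is bounded, so that
    multiplying [theta] by it preserves first moments, and that k is dominated by
    a function of x times a function of y', which is integrable for
    [theta] x [theta]. An embedding in a Hilbert space is avoided: its feature
    vectors are unbounded, so that multiplying [theta] by their coordinates could
    destroy first moments.

    The passage from finite sums to integrals approximates the identity of a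
    separable space by measurable maps with finite range
    ([separable_approximation]); for these, integrals of kernels are finite sums,
    and dominated convergence does the rest. *)

Import Order.TTheory GRing.Theory Num.Theory.
Import numFieldNormedType.Exports.
Local Open Scope classical_set_scope.
Local Open Scope ring_scope.

Local Notation L1 P f := (integrable P setT (EFin \o f)).

(** * Positive semidefinite kernels *)

Section psd_kernels.
Context {R : realType}.

Definition psd (T : Type) (k : T -> T -> R) : Prop :=
  (forall x y, k x y = k y x) /\
  forall (I : finType) (x : I -> T) (a : I -> R),
    0 <= \sum_i \sum_j a i * a j * k (x i) (x j).

Lemma psd_comp (S T : Type) (f : S -> T) (k : T -> T -> R) :
  psd T k -> psd S (fun x y => k (f x) (f y)).
Proof. by case=> ks kp; split=> [x y|I x a]; [exact: ks|exact: (kp I (f \o x))]. Qed.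

(** The form at the sum of two finitely supported signed measures; symmetry
    merges the two cross terms. *)
Lemma psd_add (T : Type) (k : T -> T -> R) : psd T k ->
  forall (I J : finType) (x : I -> T) (a : I -> R) (y : J -> T) (b : J -> R),
    0 <= \sum_i \sum_i' a i * a i' * k (x i) (x i') +
         2 * (\sum_i \sum_j a i * b j * k (x i) (y j)) +
         \sum_j \sum_j' b j * b j' * k (y j) (y j').
Proof.
move=> [ks kp] I J x a y b.
pose z (s : I + J) := match s with inl i => x i | inr j => y j end.
pose c (s : I + J) := match s with inl i => a i | inr j => b j end.
have := kp _ z c; rewrite big_sumType/=.
under eq_bigr do rewrite big_sumType/=.
under [X in _ <= _ + X -> _]eq_bigr do rewrite big_sumType/=.
rewrite !big_split/=.
rewrite [X in _ <= _ + (X + _) -> _]exchange_big/=.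
under [X in _ <= _ + (X + _) -> _]eq_bigr => i _ do
  under eq_bigr => j _ do rewrite [b j * a i]mulrC ks.
lra.
Qed.

Lemma psd_add1 (T : Type) (k : T -> T -> R) : psd T k ->
  forall (I : finType) (x : I -> T) (a : I -> R) (y : T) (t : R),
    0 <= \sum_i \sum_j a i * a j * k (x i) (x j) +
         2 * t * (\sum_i a i * k (x i) y) + t ^+ 2 * k y y.
Proof.
move=> kp I x a y t.
have := psd_add _ _ kp I 'I_1 x a (fun=> y) (fun=> t).
rewrite !big_ord1.
under [X in _ <= _ + 2 * X + _ -> _]eq_bigr do rewrite big_ord1 mulrAC.
by rewrite -big_distrl/= expr2 [_ * t]mulrC mulrA.
Qed.

Lemma ge0_affine_slope0 (a b : R) : (forall t, 0 <= a + t * b) -> b = 0.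
Proof.
move=> h; apply/eqP; apply: contraT => b0.
have := h (- (a + 1) / b); rewrite divfK//; lra.
Qed.

Lemma ge0_quadratic_slope0 (b c : R) :
  (forall t, 0 <= t * b + t ^+ 2 * c) -> b = 0.
Proof.
move=> h; apply/eqP; apply: contraT => b0.
pose e := `|c| + 1; have e0 : 0 < e by rewrite ltr_wpDl.
have := h (- b / e).
rewrite (_ : _ + _ = (b / e) ^+ 2 * (c - e)); last by field; rewrite gt_eqF.
rewrite leNgt pmulr_rlt0; first by have := ler_norm c; rewrite /e; lra.
by rewrite exprn_even_gt0//= mulf_neq0// invr_eq0 gt_eqF.
Qed.

Lemma psd_diag0 (T : Type) (k : T -> T -> R) (x y : T) :
  psd T k -> k x x = 0 -> k y x = 0.
Proof.
move=> kp kxx; apply: (@ge0_affine_slope0 (k y y)) => t.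
have := psd_add1 _ _ kp 'I_1 (fun=> y) (fun=> 1) x (t / 2).
by rewrite !big_ord1 kxx !mul1r mulr0 addr0 mulrCA divff// mulr1.
Qed.

Lemma psd_diag_ge0 (T : Type) (k : T -> T -> R) (x : T) : psd T k -> 0 <= k x x.
Proof.
by move=> [_ kp]; have := kp 'I_1 (fun=> x) (fun=> 1); rewrite !big_ord1 !mul1r.
Qed.

(** The form of the Schur complement at [a] is the minimum over [t] of the form
    of [k] at [a] plus a point mass [t] at [x0]. *)
Lemma psd_schur_complement (T : Type) (k : T -> T -> R) (x0 : T) :
  psd T k -> 0 < k x0 x0 ->
  psd T (fun x y => k x y - k x x0 * k y x0 / k x0 x0).
Proof.
move=> kp k0; split=> [x y|I x a].
  by case: kp => ks _; rewrite (ks x y) [k x x0 * _]mulrC.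
set c := k x0 x0 in k0 *.
set b := \sum_i a i * k (x i) x0.
have := psd_add1 _ _ kp I x a x0 (- b / c).
rewrite -/b -/c => h.
have -> : \sum_i \sum_j a i * a j * (k (x i) (x j) - k (x i) x0 * k (x j) x0 / c)
  = \sum_i \sum_j a i * a j * k (x i) (x j) - b ^+ 2 / c.
  rewrite expr2 {1}/b big_distrl/= big_distrl/= -sumrB; apply: eq_bigr => i _.
  rewrite /b big_distrr/= big_distrl/= -sumrB; apply: eq_bigr => j _.
  ring.
suff -> : b ^+ 2 / c = - (2 * (- b / c) * b + (- b / c) ^+ 2 * c) by rewrite opprK addrA.
by field; rewrite gt_eqF.
Qed.

(** Schur's product theorem by Gaussian elimination. As long as some diagonal
    entry of [k] is nonzero, the Schur complement splits off a rank-one summand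
    of [k], whose product with [l] is the form of [l] at rescaled coefficients.
    The induction is on the number of nonzero diagonal entries; when none is
    left, [psd_diag0] gives [k = 0]. *)
Lemma schur_product (T : Type) (k l : T -> T -> R) :
  psd T k -> psd T l -> psd T (fun x y => k x y * l x y).
Proof.
move=> kp lp; split=> [x y|I x a].
  by case: kp lp => ks _ [ls _]; rewrite ks ls.
move: kp lp => /(psd_comp _ _ x) + /(psd_comp _ _ x).
set k' := fun i j => k (x i) (x j); set l' := fun i j => l (x i) (x j).
rewrite -[X in 0 <= X]/(\sum_i \sum_j a i * a j * (k' i j * l' i j)).
move: k' l' => {}k {}l kp lp.
have [n] := ubnP #|[pred i | k i i != 0]|.
elim: n k kp => // n IH k kp.
rewrite ltnS => kn; have [/existsP[i0 ki0]|/existsPn k0] :=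
    boolP [exists i, k i i != 0]; last first.
  rewrite big1// => i _; rewrite big1// => j _.
  by rewrite (psd_diag0 _ _ j i kp) ?mul0r ?mulr0//; apply/eqP/negPn/k0.
have ki0p : 0 < k i0 i0 by rewrite lt_def ki0 psd_diag_ge0.
pose k' i j := k i j - k i i0 * k j i0 / k i0 i0.
have k'p : psd I k' by exact: psd_schur_complement.
have h' : 0 <= \sum_i \sum_j a i * a j * (k' i j * l i j).
  apply: IH => //; apply: leq_trans kn; apply/proper_card/properP.
  split; last first.
    exists i0; rewrite !inE// /k' mulfK// ?subrr ?eqxx//.
  apply/fintype.subsetP => i; rewrite !inE; apply: contraNN => /eqP kii.
  rewrite /k' kii [k i i0](_ : _ = 0) ?mul0r ?subrr//.
  by case: (kp) => -> _; exact: psd_diag0.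
case: lp => _ /(_ I id (fun i => a i * k i i0)) lp.
have -> : \sum_i \sum_j a i * a j * (k i j * l i j) =
  \sum_i \sum_j a i * a j * (k' i j * l i j) +
  (\sum_i \sum_j a i * k i i0 * (a j * k j i0) * l i j) / k i0 i0.
  rewrite big_distrl -big_split/=; apply: eq_bigr => i _.
  rewrite big_distrl -big_split/=; apply: eq_bigr => j _.
  by rewrite /k'; ring.
by rewrite addr_ge0// divr_ge0// ltW.
Qed.

End psd_kernels.

Arguments psd {R T} k.
Arguments psd_add {R T k}.
Arguments psd_add1 {R T k}.
Arguments psd_comp {R S T} f {k}.

Section negative_type_kernel.
Context {R : realType} {X : pointedMetricType R}.

Lemma negative_type_fin : negative_type X ->
  forall (I : finType) (x : I -> X) (a : I -> R), \sum_i a i = 0 ->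
    \sum_i \sum_j a i * a j * mdist (x i) (x j) <= 0.
Proof.
move=> negX I x a a0.
have := negX #|I| (x \o enum_val) (a \o enum_val).
have E (F : I -> R) : \sum_(i < #|I|) F (enum_val i) = \sum_i F i.
  rewrite [RHS](reindex (enum_val : 'I_#|I| -> I))//.
  by apply: onW_bij; exact: enum_val_bij.
rewrite /= E => /(_ a0).
congr (_ <= 0); rewrite -[RHS]E; apply: eq_bigr => i _.
by rewrite -[RHS]E.
Qed.

(** A weight opposite to the total mass of [a], placed at [o], turns arbitrary
    coefficients into coefficients of sum 0. *)
Lemma negative_type_psd (o : X) : negative_type X ->
  psd (fun x y : X => mdist x o + mdist y o - mdist x y).
Proof.
move=> negX; split=> [x y|I x a].
  by rewrite [mdist y x]metric_sym [_ + mdist y o]addrC.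
set s := \sum_i a i.
pose z (u : I + 'I_1) : X := match u with inl i => x i | inr _ => o end.
pose c (u : I + 'I_1) : R := match u with inl i => a i | inr _ => - s end.
have := negative_type_fin negX _ z c.
rewrite big_sumType/= big_ord1 subrr => /(_ erefl).
rewrite big_sumType/=.
under eq_bigr do rewrite big_sumType/= big_ord1.
rewrite big_ord1 big_sumType/= big_ord1 mdistxx mulr0 addr0 big_split/=.
set A := \sum_i a i * mdist (x i) o.
have -> : \sum_i a i * - s * mdist (x i) o = - s * A.
  by rewrite /A big_distrr; apply: eq_bigr => i _; rewrite /= mulrCA mulrA.
have -> : \sum_i - s * a i * mdist o (x i) = - s * A.
  by rewrite /A big_distrr; apply: eq_bigr => i _; rewrite /= metric_sym mulrA.
set Q := \sum_i _.
move=> h; have -> : \sum_i \sum_j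
    a i * a j * (mdist (x i) o + mdist (x j) o - mdist (x i) (x j))
  = s * A + s * A - Q; last by lra.
rewrite {1}[s * A]mulrC {1}/A {1}/s /A /Q !big_distrl/= -big_split/= -sumrB.
apply: eq_bigr => i _; rewrite !big_distrr/= -big_split/= -sumrB.
by apply: eq_bigr => j _; ring.
Qed.

End negative_type_kernel.

(** * Integrals of real-valued functions *)

Section real_integrals.
Context {d} {T : measurableType d} {R : realType}.

Lemma L1_measurable {P : {measure set T -> \bar R}} {f : T -> R} :
  L1 P f -> measurable_fun setT f.
Proof. by move=> /integrableP[] /measurable_EFinP. Qed.

Lemma L1_le {P : {measure set T -> \bar R}} (f g : T -> R) :
  measurable_fun setT f -> (forall u, `|f u| <= g u) -> L1 P g -> L1 P f.
Proof.
move=> mf fg; apply: le_integrable => //; first exact/measurable_EFinP.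
by move=> u _ /=; rewrite lee_fin (le_trans (fg u))// ler_norm.
Qed.

Lemma L1D {P : {measure set T -> \bar R}} {f g : T -> R} :
  L1 P f -> L1 P g -> L1 P (fun u => f u + g u).
Proof. by move=> Pf Pg; apply: eq_integrable (integrableD _ Pf Pg). Qed.

Lemma L1B {P : {measure set T -> \bar R}} {f g : T -> R} :
  L1 P f -> L1 P g -> L1 P (fun u => f u - g u).
Proof. by move=> Pf Pg; apply: eq_integrable (integrableB _ Pf Pg). Qed.

Lemma L1Zl {P : {measure set T -> \bar R}} (c : R) {f : T -> R} :
  L1 P f -> L1 P (fun u => c * f u).
Proof. by move=> Pf; apply: eq_integrable (integrableZl _ c Pf). Qed.

Lemma L1_cst {P : probability T R} (c : R) : L1 P (fun=> c).
Proof. exact: finite_measure_integrable_cst. Qed.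

Lemma Rint_cst (P : probability T R) (c : R) : \int[P]_u c = c.
Proof.
rewrite Rintegral_cst//.
have -> : fine (P setT) = 1 by rewrite probability_setT.
exact: mulr1.
Qed.

Lemma L1_bounded (P : probability T R) (f : T -> R) (c : R) :
  measurable_fun setT f -> (forall u, `|f u| <= c) -> L1 P f.
Proof.
move=> mf fc; apply: (L1_le f (cst c)) => //.
exact: finite_measure_integrable_cst.
Qed.

Lemma Rintegral_finite_range (P : probability T R) (I : finType)
    (r : T -> I) (f : I -> R) :
  (forall i, measurable (r @^-1` [set i])) ->
  \int[P]_u f (r u) = \sum_i f i * fine (P (r @^-1` [set i])).
Proof.
move=> mr; rewrite /Rintegral.
transitivity (fine (\int[P]_u (\sum_i (f i * \1_(r @^-1` [set i]) u)%:E))%E).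
  congr fine; apply: eq_integral => u _; rewrite sumEFin; congr EFin.
  rewrite (bigD1 (r u))//= indicE mem_set// mulr1 big1 ?addr0// => i iu.
  by rewrite indicE memNset ?mulr0//= => iE; rewrite iE eqxx in iu.
have ind i : P.-integrable setT (fun u => (\1_(r @^-1` [set i]) u)%:E).
  by apply: integrable_indic.
rewrite integral_sum//; last by move=> i; exact: (integrableZl _ _ (ind i)).
rewrite (_ : (\sum_i _)%E = (\sum_i (f i * fine (P (r @^-1` [set i])))%:E)%E).
  by rewrite sumEFin.
apply: eq_bigr => i _; under eq_integral do rewrite EFinM.
by rewrite integralZl// integral_indic// setIT EFinM fineK// fin_num_measure.
Qed.

Lemma Rintegral_dominated_cvg (P : {measure set T -> \bar R})
    (f_ : nat -> T -> R) (f g : T -> R) :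
  (forall n, measurable_fun setT (f_ n)) -> measurable_fun setT f ->
  (forall u, f_ n u @[n --> \oo] --> f u) ->
  (forall n u, `|f_ n u| <= g u) -> L1 P g ->
  (\int[P]_u f_ n u) @[n --> \oo] --> \int[P]_u f u.
Proof.
move=> mf_ mf cf fg ig.
have mf_E n : measurable_fun setT (EFin \o f_ n) by exact/measurable_EFinP.
have mfE : measurable_fun setT (EFin \o f) by exact/measurable_EFinP.
have cE : {ae P, forall u, setT u -> (EFin \o f_ n) u @[n --> \oo] --> (EFin \o f) u}.
  by apply: aeW => u _; apply: cvg_EFin; [exact: nearW|exact: cf].
have bE : {ae P, forall u n, setT u -> (`|(EFin \o f_ n) u| <= (EFin \o g) u)%E}.
  by apply: aeW => u n _; rewrite /= lee_fin.
have [if_ _ h] := dominated_convergence measurableT mf_E mfE cE ig bE.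
apply: fine_cvg; rewrite fineK//.
exact: integrable_fin_num.
Qed.

End real_integrals.

Section product_integrals.
Context {d1 d2} {T1 : measurableType d1} {T2 : measurableType d2} {R : realType}.
Variables (P : probability T1 R) (Q : probability T2 R).

Lemma L1_prod (f : T1 -> R) (g : T2 -> R) : L1 P f -> L1 Q g ->
  L1 (P \x Q)%E (fun w => f w.1 * g w.2).
Proof.
move=> Pf Qg; have mf := L1_measurable Pf; have mg := L1_measurable Qg.
apply/integrable12ltyP => /=.
  apply/measurable_EFinP; apply: measurable_funM.
    exact: measurableT_comp mf measurable_fst.
  exact: measurableT_comp mg measurable_snd.
have [_ f1] := integrableP _ _ _ Pf; have [_ g1] := integrableP _ _ _ Qg.
rewrite (eq_integral (fun x => (`|(f x)%:E| * \int[Q]_y `|(g y)%:E|)%E)).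
  rewrite ge0_integralZr//.
  - by rewrite lte_mul_pinfty// ?integral_ge0// ge0_fin_numE// integral_ge0.
  - by do 2 apply/measurableT_comp => //.
  - exact: integral_ge0.
move=> x _; rewrite -ge0_integralZl//; last by do 2 apply/measurableT_comp => //.
by apply: eq_integral => y _; rewrite /= normrM EFinM.
Qed.

Lemma L1_fst (f : T1 -> R) : L1 P f -> L1 (P \x Q)%E (fun w => f w.1).
Proof.
move=> Pf; have := L1_prod f (cst 1) Pf (finite_measure_integrable_cst _ _ measurableT).
by apply: eq_integrable => // w _ /=; rewrite mulr1.
Qed.

Lemma Rintegral_fubini (F : T1 * T2 -> R) :
  L1 (P \x Q)%E F -> (forall x, L1 Q (fun y => F (x, y))) ->
  \int[(P \x Q)%E]_w F w = \int[P]_x \int[Q]_y F (x, y).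
Proof.
move=> LF LFx; rewrite /Rintegral -integral12_prod_meas1//; congr fine.
apply: eq_integral => x _; rewrite /= fineK//.
exact: integrable_fin_num (LFx x).
Qed.

Lemma Rintegral_prod (f : T1 -> R) (g : T2 -> R) : L1 P f -> L1 Q g ->
  \int[(P \x Q)%E]_w (f w.1 * g w.2) = (\int[P]_x f x) * (\int[Q]_y g y).
Proof.
move=> Pf Qg; rewrite Rintegral_fubini/=; [|exact: L1_prod|by move=> x; exact: L1Zl].
by rewrite -RintegralZr//; apply: eq_Rintegral => x _; rewrite RintegralZl.
Qed.

End product_integrals.

Section law_integrals.
Context {d d'} {Z : measurableType d} {T : measurableType d'} {R : realType}.
Context (P : probability Z R) (phi : {mfun Z >-> T}).

Lemma L1_distribution (f : T -> R) :
  L1 (distribution P phi) f -> L1 P (fun z => f (phi z)).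
Proof.
move=> /integrableP[mf fy]; apply/integrableP; split.
  exact: measurableT_comp mf (measurable_funPT phi).
rewrite ge0_integral_distribution// in fy.
exact: measurableT_comp.
Qed.

Lemma Rintegral_distribution (f : T -> R) : L1 (distribution P phi) f ->
  \int[distribution P phi]_x f x = \int[P]_z f (phi z).
Proof.
move=> fL; rewrite /Rintegral integral_distribution//.
- exact: measurable_int fL.
- exact: L1_distribution.
Qed.

End law_integrals.

(** * Integrated positive semidefinite kernels *)

(** The map is factored through a finite type with measurable fibers, so that the
    points [z i] may coincide and need not be measurable as singletons. *)
Definition finite_range {d} {T : measurableType d} (q : T -> T) : Prop :=
  exists (I : finType) (r : T -> I) (z : I -> T),
    (forall i, measurable (r @^-1` [set i])) /\ q = z \o r.

Lemma finite_range_measurable {d} {T : measurableType d} (q : T -> T) :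
  finite_range q -> measurable_fun setT q.
Proof.
move=> [I [r [z [mr ->]]]] _ A mA; rewrite setTI.
have -> : (z \o r) @^-1` A = \bigcup_(i in z @^-1` A) (r @^-1` [set i]).
  by apply/seteqP; split=> [u Azu|u [i Azi /= ui]]; [exists (r u)|rewrite /= ui].
by apply: fin_bigcup_measurable => [|i _]; [exact: finite_finset|exact: mr].
Qed.

Lemma finite_range_pair {d1 d2} {T1 : measurableType d1} {T2 : measurableType d2}
    (q1 : T1 -> T1) (q2 : T2 -> T2) :
  finite_range q1 -> finite_range q2 ->
  finite_range (fun w : T1 * T2 => (q1 w.1, q2 w.2)).
Proof.
move=> [I [r [z [mr ->]]]] [J [s [y [ms ->]]]].
exists (I * J)%type, (fun w => (r w.1, s w.2)), (fun i => (z i.1, y i.2)).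
split=> // i.
rewrite (_ : _ @^-1` _ = (r @^-1` [set i.1]) `*` (s @^-1` [set i.2])).
  exact: measurableX.
by apply/seteqP; split=> w /=; [move=> <-|case: i => ? ? [-> ->]].
Qed.

Section psd_integral.
Context {d} {T : measurableType d} {R : realType} (P : probability T R).
Context {k : T -> T -> R}.

(** The form of [k] at the point masses [a] plus [s] times the law of [q]. *)
Let psd_expr (q : T -> T) (I : finType) (x : I -> T) (a : I -> R) (s : R) : R :=
  \sum_i \sum_j a i * a j * k (x i) (x j) +
  2 * s * (\sum_i a i * \int[P]_u k (q u) (x i)) +
  s ^+ 2 * \int[(P \x P)%E]_w k (q w.1) (q w.2).

(** The law of [q] is finitely supported, so this is an instance of [psd_add]. *)
Lemma psd_finite_range (q : T -> T) (I : finType) (x : I -> T) (a : I -> R) (s : R) :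
  psd k -> finite_range q -> 0 <= psd_expr q I x a s.
Proof.
move=> kp [J [r [z [mr ->]]]]; rewrite /psd_expr.
pose p j := fine (P (r @^-1` [set j])).
(* [w |-> (r w.1, r w.2)] has rectangles as fibers, of product measure *)
have -> : \int[(P \x P)%E]_w k ((z \o r) w.1) ((z \o r) w.2) =
    \sum_j \sum_j' p j * p j' * k (z j) (z j').
  have := Rintegral_finite_range (P \x P)%E (J * J)%type (fun w => (r w.1, r w.2))
    (fun j => k (z j.1) (z j.2)).
  have rE (j : J * J) : (fun w : T * T => (r w.1, r w.2)) @^-1` [set j] =
      (r @^-1` [set j.1]) `*` (r @^-1` [set j.2]).
    by apply/seteqP; split=> w /=; [move=> <-|case: j => ? ? [-> ->]].
  move=> ->; last by move=> j; rewrite rE; exact: measurableX.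
  rewrite pair_bigA/=; apply: eq_bigr => j _.
  by rewrite rE product_measure1E// fineM ?fin_num_measure// mulrC.
have E i : \int[P]_u k ((z \o r) u) (x i) = \sum_j p j * k (z j) (x i).
  rewrite (Rintegral_finite_range P J r (fun j => k (z j) (x i)))//.
  by apply: eq_bigr => j _; rewrite mulrC.
under [X in _ <= _ + _ * X + _]eq_bigr do rewrite E.
have := psd_add kp I J x a z (fun j => s * p j).
set S := \sum_i \sum_j _; set A := \sum_i \sum_j _; set B := \sum_i \sum_j _.
congr (_ <= S + _ + _).
- rewrite -mulrA; congr (2 * _); rewrite /A big_distrr/=; apply: eq_bigr => i _.
  rewrite !big_distrr/=; apply: eq_bigr => j _; case: kp => -> _; ring.
- rewrite /B big_distrr/=; apply: eq_bigr => i _.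
  rewrite !big_distrr/=; apply: eq_bigr => j _; ring.
Qed.

(** The form of [k] at [s P] plus the point masses [a] is the limit of the forms
    at [s] times the law of [q n] plus the same point masses. The kernels of
    interest are unbounded when the space is, so domination is required of the
    approximants as well, uniformly in [n]. *)
Lemma psd_integral (q : nat -> T -> T) (h : T -> T -> R) (g : T * T -> R) :
  psd k -> measurable_fun setT (fun w : T * T => k w.1 w.2) ->
  (forall n, finite_range (q n)) ->
  (forall u x, k (q n u) x @[n --> \oo] --> k u x) ->
  (forall u v, k (q n u) (q n v) @[n --> \oo] --> k u v) ->
  (forall n u x, `|k (q n u) x| <= h x u) -> (forall x, L1 P (h x)) ->
  (forall n w, `|k (q n w.1) (q n w.2)| <= g w) -> L1 (P \x P)%E g ->
  forall (I : finType) (x : I -> T) (a : I -> R) (s : R),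
  0 <= \sum_i \sum_j a i * a j * k (x i) (x j) +
    2 * s * (\sum_i a i * \int[P]_u k u (x i)) +
    s ^+ 2 * \int[(P \x P)%E]_w k w.1 w.2.
Proof.
move=> kp mk fq ck1 ck2 kh ih kg ig I x a s.
have mq n : measurable_fun setT (q n) by exact: finite_range_measurable.
have mk1 y : measurable_fun setT (fun u => k u y).
  by apply: (measurableT_comp mk (g := fun u => (u, y))); exact: measurable_fun_pair.
have mq2 n : measurable_fun setT (fun w : T * T => (q n w.1, q n w.2)).
  by apply: measurable_fun_pair; exact: measurableT_comp.
suff : psd_expr (q n) I x a s @[n --> \oo] --> psd_expr id I x a s.
  move=> cv; apply: (@closed_cvg _ _ _ _ _ (fun y : R => 0 <= y) _ _ _ cv).
    exact: closed_ge.
  by apply: nearW => n; exact: psd_finite_range.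
apply: cvgD; first apply: cvgD; first exact: cvg_cst.
- apply: cvgM; first exact: cvg_cst.
  apply: cvg_big => [|i _]; first exact: add_continuous.
  apply: cvgM; first exact: cvg_cst.
  apply: (@Rintegral_dominated_cvg _ _ _ _ _ _ (h (x i))) => //.
  by move=> n; exact: measurableT_comp (mk1 (x i)) (mq n).
- apply: cvgM; first exact: cvg_cst.
  apply: (@Rintegral_dominated_cvg _ _ _ _ _ _ g) => //.
  by move=> n; exact: measurableT_comp mk (mq2 n).
Qed.

End psd_integral.

(** * Separable metric spaces *)

Section metric_lemmas.
Context {R : realType} {X : pointedMetricType R}.
Implicit Types x y : X.

Lemma mdist_lipschitz x y x' y' :
  `|mdist x y - mdist x' y'| <= mdist x x' + mdist y y'.
Proof.
have := metric_triangle x x' y; have := metric_triangle x' y' y.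
have := metric_triangle x' x y'; have := metric_triangle x y y'.
rewrite (metric_sym y' y) (metric_sym x' x) => h1 h2 h3 h4.
rewrite ler_norml; lra.
Qed.

Lemma cvg_dominated_dist (u : nat -> R) (l : R) (e : nat -> R) :
  (forall n, `|u n - l| <= e n) -> e n @[n --> \oo] --> 0 ->
  u n @[n --> \oo] --> l.
Proof.
move=> ue /cvgrPdist_lt e0; apply/cvgrPdist_lt => eps /e0; apply: filterS => n.
rewrite sub0r normrN distrC => /(le_lt_trans (ler_norm _)).
by apply: le_lt_trans; exact: ue.
Qed.

Lemma cvg_mdist (u v : nat -> X) x y :
  mdist (u n) x @[n --> \oo] --> 0 -> mdist (v n) y @[n --> \oo] --> 0 ->
  mdist (u n) (v n) @[n --> \oo] --> mdist x y.
Proof.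
move=> ux vy; apply: (@cvg_dominated_dist _ _ (fun n => mdist (u n) x + mdist (v n) y)).
  by move=> n; exact: mdist_lipschitz.
by rewrite -[0]addr0; exact: cvgD.
Qed.

(** Distances to a point and mean distances are 1-Lipschitz, hence Borel by
    continuity. *)
Lemma lipschitz_measurable (f : X -> R) :
  (forall x y, `|f x - f y| <= mdist x y) ->
  measurable_fun (setT : set (borel X)) f.
Proof.
move=> fl mD; apply: (measurability _ (RGenOInfty.measurableE R)) => //.
move=> /= _ [_ [a ->] <-]; rewrite setTI preimage_itvoy.
apply: sub_sigma_algebra; rewrite openE => x /= ax.
apply/metricType_numDomainType.nbhs_mdistP; exists (f x - a) => /=.
  by rewrite subr_gt0.
move=> y /= xy; have := fl x y; rewrite ler_norml => /andP[_]; lra.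
Qed.

Lemma measurable_mdistl x : measurable_fun (setT : set (borel X)) (mdist x : X -> R).
Proof.
apply: lipschitz_measurable => y z.
by have := mdist_lipschitz x y x z; rewrite mdistxx add0r.
Qed.

Lemma separable_dense_sequence : separable X ->
  exists e : nat -> X, forall x (eps : R), 0 < eps -> exists i, mdist x (e i) < eps.
Proof.
move=> [S /countable_injP[f fS] dS].
exists (fun i => xget point [set s | S s /\ f s = i]) => x eps eps0.
have [|y [/interior_subset xy Sy]] := dS (interior (ball x eps)) _ (@open_interior _ _).
  by exists x; apply: nbhsx_ballx.
exists (f y); rewrite ballEmdist in xy.
suff -> : xget point [set s | S s /\ f s = f y] = y by [].
apply: xget_subset1 => // s t [Ss fs] [St ft].
by apply: fS; rewrite ?inE// fs ft.
Qed.

(** Without separability, the product of the Borel sigma-algebras may be too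
    small for the distance. With a dense sequence [e], the set d(x, y) < a is the
    countable union of the sets d(e i, x) + d(e i, y) < a. *)
Lemma measurable_mdist : separable X ->
  measurable_fun (setT : set (borel X * borel X)) (fun w => mdist (w.1 : X) (w.2 : X) : R).
Proof.
move=> /separable_dense_sequence[e de] mD.
apply: (measurability _ (RGenInftyO.measurableE R)) => //.
move=> /= _ [_ [a ->] <-]; rewrite setTI preimage_itvNyo.
rewrite [X in measurable X](_ : _ = \bigcup_i
    [set w : borel X * borel X | mdist (e i) w.1 + mdist (e i) w.2 < a]).
  apply: bigcupT_measurable => i.
  have mf : measurable_fun (setT : set (borel X * borel X))
      (fun w => mdist (e i) w.1 + mdist (e i) w.2).
    apply: measurable_funD.
      exact: measurableT_comp (measurable_mdistl (e i)) measurable_fst.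
    exact: measurableT_comp (measurable_mdistl (e i)) measurable_snd.
  have := mf measurableT `]-oo, a[%classic (measurable_itv _).
  by rewrite setTI preimage_itvNyo.
apply/seteqP; split=> [[x y]/= xya|[x y]/= [i _ /= xya]].
  have [|i xi] := de x ((a - mdist x y) / 2); first by rewrite divr_gt0// subr_gt0.
  exists i => //=; have := metric_triangle (e i) x y.
  by rewrite (metric_sym (e i) x); lra.
have := metric_triangle x (e i) y; rewrite (metric_sym x (e i)); lra.
Qed.

(** [q n x] is the point nearest to [x] among the first [n.+1] points of a dense
    sequence. The first point [o] is always a candidate, hence the bound by
    [mdist x o], which is what dominates integrands composed with [q n]. *)
Lemma separable_approximation : separable X ->
  exists (o : X) (q : nat -> X -> X),
    [/\ forall n, @finite_range _ (borel X) (q n),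
        forall n x, mdist (q n x) x <= mdist x o &
        forall x, mdist (q n x) x @[n --> \oo] --> 0].
Proof.
move=> /separable_dense_sequence[e de].
(* [r n x] is the index of the nearest point, the least one in case of ties *)
pose r := fix r (n : nat) (x : X) : nat := if n is n'.+1 then
  (if mdist (e n) x < mdist (e (r n' x)) x then n else r n' x) else 0%N.
have rn n x : (r n x <= n)%N.
  by elim: n => //= n IH; case: ifP => // _; exact: leqW.
have rmin n i x : (i <= n)%N -> mdist (e (r n x)) x <= mdist (e i) x.
  elim: n => [|n IH]; first by rewrite leqn0 => /eqP ->.
  rewrite leq_eqVlt => /predU1P[->/=|]; first by case: ifPn => //; rewrite -leNgt.
  by rewrite ltnS => /IH; apply: le_trans => /=; case: ifPn => // /ltW.
have mr n : measurable_fun (setT : set (borel X)) (r n) /\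
    measurable_fun (setT : set (borel X)) (fun x => mdist (e (r n x)) x : R).
  elim: n => [|n [IH1 IH2]].
    by split; [exact: measurable_cst|exact: (measurable_mdistl (e 0%N))].
  have mc := measurable_fun_ltr (measurable_mdistl (e n.+1)) IH2.
  split.
    rewrite (_ : r n.+1 = fun x =>
      if mdist (e n.+1) x < mdist (e (r n x)) x then n.+1 else r n x)//.
    exact: measurable_fun_ifT.
  rewrite [X in measurable_fun _ X](_ : _ = fun x =>
    if mdist (e n.+1) x < mdist (e (r n x)) x then mdist (e n.+1) x
    else mdist (e (r n x)) x); last by apply/funext => x /=; case: ifP.
  by apply: measurable_fun_ifT => //; exact: measurable_mdistl.
exists (e 0%N), (fun n x => e (r n x)); split.
- move=> n; exists 'I_n.+1,
    (fun x => Ordinal (rn n x : (r n x < n.+1)%N)), (fun i : 'I_n.+1 => e i); split=> // i.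
  have := (mr n).1 measurableT [set (i : nat)] I.
  rewrite setTI; congr measurable; apply/seteqP; split=> x /=.
    by move=> ri; apply/val_inj.
  by move=> /(congr1 val).
- by move=> n x; rewrite [leRHS]metric_sym; exact: rmin.
- move=> x; apply/cvgrPdist_lt => eps eps0.
  have [i xi] := de x _ eps0.
  exists i => // n /= /(rmin _ _ x) h.
  rewrite sub0r normrN ger0_norm ?mdist_ge0//.
  by rewrite (le_lt_trans h)// metric_sym.
Qed.

End metric_lemmas.

(** * Integration against signed measures *)

Section charge_integrals.
Context {d} {T : measurableType d} {R : realType}.

Lemma L1_le_measure (m1 m2 : {measure set T -> \bar R}) (f : T -> R) :
  (forall A, measurable A -> (m1 A <= m2 A)%E) -> L1 m2 f -> L1 m1 f.
Proof.
move=> m12 /integrableP[mf f2]; apply/integrableP; split=> //.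
apply: le_lt_trans f2; apply: ge0_le_measure_integral => //.
exact: measurableT_comp.
Qed.

(** Two decompositions of [nu] as a difference of finite measures agree after
    moving the negative parts to the other side, and both Jordan parts lie below
    [m1] and [m2], so that integrability passes to them. *)
Lemma charge_integral_sub (nu : {charge set T -> \bar R})
    (m1 m2 : {finite_measure set T -> \bar R}) (f : T -> R) :
  (forall A, measurable A -> nu A = (m1 A - m2 A)%E) ->
  L1 m1 f -> L1 m2 f ->
  charge_integral nu f = \int[m1]_u f u - \int[m2]_u f u.
Proof.
move=> nuE f1 f2; rewrite /charge_integral.
set PN := svalP (hahn_pair nu); have [[mP _] [mN _] _ _] := PN.
set p := jordan_pos PN; set n := jordan_neg PN.
have pE A : measurable A -> p A = (m1 (A `&` (sval (hahn_pair nu)).1) -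
    m2 (A `&` (sval (hahn_pair nu)).1))%E.
  move=> mA; rewrite -nuE ?/p; last exact: measurableI.
  by rewrite jordan_posE cjordan_posE /crestr0 mem_set.
have nE A : measurable A -> n A = (m2 (A `&` (sval (hahn_pair nu)).2) -
    m1 (A `&` (sval (hahn_pair nu)).2))%E.
  move=> mA.
  rewrite /n jordan_negE cjordan_negE /crestr0 mem_set// /crestr.
  by rewrite nuE ?fin_num_oppeB ?fin_num_measure//; [rewrite addeC|exact: measurableI..].
have leB (m m' : {finite_measure set T -> \bar R}) (A B : set T) :
    measurable A -> measurable B -> (m (A `&` B) - m' (A `&` B) <= m A)%E.
  move=> mA mB; rewrite leeBlDr ?fin_num_measure//; last exact: measurableI.
  apply: (@le_trans _ _ (m A)); last by rewrite leeDl.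
  by rewrite le_measure ?inE//; exact: measurableI.
have pm A : measurable A -> (p A <= m1 A)%E by move=> mA; rewrite pE// leB.
have nm A : measurable A -> (n A <= m2 A)%E by move=> mA; rewrite nE// leB.
have fp : L1 p f by apply: (L1_le_measure _ m1).
have fn : L1 n f by apply: (L1_le_measure _ m2).
have mf := L1_measurable f1.
have := eq_measure_integral (measure_add m1 n)
  (f := EFin \o f) (D := setT) (m1 := measure_add p m2).
rewrite !integral_measure_add//; try exact/measurable_EFinP.
move=> h; apply/eqP; rewrite subr_eq addrAC eq_sym subr_eq eq_sym; apply/eqP.
rewrite /Rintegral -!fineD; try exact: integrable_fin_num.
congr fine; apply: h => A mA _.
transitivity (p A + m2 A)%E; first exact: measure_addE.
transitivity (m1 A + n A)%E; last exact/esym/measure_addE.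
have : (m1 A - m2 A = p A - n A)%E.
  by rewrite -nuE// (jordan_decomp PN mA)/= /cadd/= cscaleN1.
have : p A \is a fin_num by exact: fin_num_measure.
have : n A \is a fin_num by exact: fin_num_measure.
have : m1 A \is a fin_num by exact: fin_num_measure.
have : m2 A \is a fin_num by exact: fin_num_measure.
case: (p A) (n A) (m1 A) (m2 A) => [a||] [b||] [c||] [e||]//= _ _ _ _.
by move=> -[ceab]; congr EFin; lra.
Qed.

Lemma charge_integral_measure (m : {finite_measure set T -> \bar R}) (f : T -> R) :
  L1 m f -> charge_integral (charge_of_finite_measure m) f = \int[m]_u f u.
Proof.
move=> fm; rewrite (charge_integral_sub _ m mzero)//.
- rewrite [X in _ - X](_ : _ = 0) ?subr0//.
  by rewrite /Rintegral integral_measure_zero.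
- by move=> A mA; rewrite /mzero sube0.
- apply/integrableP; split; first exact/measurable_EFinP/L1_measurable/fm.
  by rewrite integral_measure_zero.
Qed.

Lemma charge_integral_measure_sub (m1 m2 : {finite_measure set T -> \bar R})
    (f : T -> R) :
  L1 m1 f -> L1 m2 f ->
  charge_integral (cadd (charge_of_finite_measure m1)
    (copp (charge_of_finite_measure m2))) f = \int[m1]_u f u - \int[m2]_u f u.
Proof. exact: charge_integral_sub. Qed.

End charge_integrals.

(** * The centered distance *)

Section centered_distance.
Context {R : realType} {X : pointedMetricType R}.
Variable mu : probability (borel X) R.
Hypothesis mu1 : finite_first_moment mu.

(** The functions of the doubly centered distance, written with integrals against
    the law itself: no Jordan decomposition is involved, and
    [centered_dist_measure] makes the link. *)
Definition mean_dist (x : X) : R := \int[mu]_y mdist x (y : X).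
Definition mean_mean_dist : R := \int[mu]_x mean_dist x.
Definition cdist (x y : X) : R :=
  mdist x y - mean_dist x - mean_dist y + mean_mean_dist.

Lemma L1_mdist (x : X) : L1 mu (mdist x : borel X -> R).
Proof.
have [p p_lty] := mu1.
apply: (L1_le _ (fun y : borel X => mdist x p + mdist (y : X) p)).
- exact: measurable_mdistl.
- move=> y; rewrite ger0_norm ?mdist_ge0// (metric_sym y p).
  exact: metric_triangle.
- apply: L1D; first exact: L1_cst.
  apply/integrableP; split.
    apply/measurable_EFinP; under eq_fun do rewrite metric_sym.
    exact: measurable_mdistl.
  by under eq_integral do rewrite /= ger0_norm ?mdist_ge0//.
Qed.

Lemma mean_dist_ge0 (x : X) : 0 <= mean_dist x.
Proof. by apply: Rintegral_ge0 => y _; exact: mdist_ge0. Qed.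

Lemma mean_dist_le (x y : X) : mean_dist x <= mdist x y + mean_dist y.
Proof.
rewrite -[mdist x y](Rint_cst mu) -RintegralD//; [|exact: L1_cst|exact: L1_mdist].
apply: le_Rintegral => //; first exact: L1_mdist.
  by apply: L1D; [exact: L1_cst|exact: L1_mdist].
by move=> z _; exact: metric_triangle.
Qed.

(** Average the triangle inequality over the intermediate point. *)
Lemma mdist_le_mean_dist (x y : X) : mdist x y <= mean_dist x + mean_dist y.
Proof.
rewrite -[leLHS](Rint_cst mu) -RintegralD//; [|exact: L1_mdist..].
apply: le_Rintegral => //; first exact: L1_cst.
  by apply: L1D; exact: L1_mdist.
by move=> z _; rewrite (metric_sym y z); exact: metric_triangle.
Qed.

Lemma mean_dist_lipschitz (x y : X) : `|mean_dist x - mean_dist y| <= mdist x y.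
Proof.
have := mean_dist_le x y; have := mean_dist_le y x.
by rewrite (metric_sym y x) ler_norml => ? ?; lra.
Qed.

Lemma measurable_mean_dist : measurable_fun (setT : set (borel X)) mean_dist.
Proof. exact: lipschitz_measurable mean_dist_lipschitz. Qed.

Lemma L1_mean_dist : L1 mu (mean_dist : borel X -> R).
Proof.
pose p : X := point.
apply: (L1_le _ (fun y : borel X => mdist p y + mean_dist p)).
- exact: measurable_mean_dist.
- move=> y; rewrite ger0_norm ?mean_dist_ge0// (metric_sym p y).
  exact: mean_dist_le.
- by apply: L1D; [exact: L1_mdist|exact: L1_cst].
Qed.

Lemma mean_mean_dist_ge0 : 0 <= mean_mean_dist.
Proof. by apply: Rintegral_ge0 => x _; exact: mean_dist_ge0. Qed.

Lemma mean_mean_dist_le (x : X) : mean_mean_dist <= 2 * mean_dist x.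
Proof.
rewrite (_ : 2 * mean_dist x = \int[mu]_y (mdist x y + mean_dist x)).
  apply: le_Rintegral => //; first exact: L1_mean_dist.
    by apply: L1D; [exact: L1_mdist|exact: L1_cst].
  by move=> y _; rewrite (metric_sym x y); exact: mean_dist_le.
rewrite RintegralD//; [|exact: L1_mdist|exact: L1_cst].
by rewrite Rint_cst mulr_natl mulr2n.
Qed.

Lemma cdist_sym (x y : X) : cdist x y = cdist y x.
Proof. by rewrite /cdist metric_sym; ring. Qed.

(** Both d(x, y) - a(x) and a(y) - D have absolute value at most a(y). *)
Lemma cdist_boundr (x y : X) : `|cdist x y| <= 2 * mean_dist y.
Proof.
rewrite /cdist.
have := mean_dist_le x y; have := mdist_le_mean_dist x y.
have := mean_mean_dist_le y; have := mean_mean_dist_ge0; have := mean_dist_ge0 y.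
rewrite ler_norml; lra.
Qed.

Lemma cdist_boundl (x y : X) : `|cdist x y| <= 2 * mean_dist x.
Proof. by rewrite cdist_sym cdist_boundr. Qed.

Lemma measurable_cdistl (y : X) :
  measurable_fun (setT : set (borel X)) (fun x : borel X => cdist x y).
Proof.
rewrite /cdist; apply: measurable_funD; last exact: measurable_cst.
apply: measurable_funB; last exact: measurable_cst.
apply: measurable_funB; last exact: measurable_mean_dist.
by under eq_fun do rewrite metric_sym; exact: measurable_mdistl.
Qed.

Lemma L1_cdist (y : X) : L1 mu (fun x : borel X => cdist x y).
Proof.
by apply: L1_bounded (measurable_cdistl y) _ => x; exact: cdist_boundr.
Qed.

Lemma Rintegral_cdist (y : X) : \int[mu]_x cdist (x : X) y = 0.
Proof.
have dL : L1 mu (fun x : borel X => mdist (x : X) y).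
  by under eq_fun do rewrite metric_sym; exact: L1_mdist.
have aL := L1_mean_dist.
rewrite /cdist RintegralD//; [|exact: (L1B (L1B dL aL) (L1_cst _))|exact: L1_cst].
rewrite RintegralB//; [|exact: (L1B dL aL)|exact: L1_cst].
rewrite RintegralB// !Rint_cst -/mean_mean_dist.
by under eq_Rintegral do rewrite metric_sym; rewrite -/(mean_dist y); ring.
Qed.

Lemma measurable_cdist : separable X -> measurable_fun
  (setT : set (borel X * borel X)) (fun w => cdist w.1 w.2).
Proof.
move=> sepX; rewrite /cdist; apply: measurable_funD; last exact: measurable_cst.
apply: measurable_funB; last exact: measurableT_comp measurable_mean_dist measurable_snd.
apply: measurable_funB; last exact: measurableT_comp measurable_mean_dist measurable_fst.
exact: measurable_mdist.
Qed.

Lemma cvg_mean_dist (u : nat -> X) (x : X) :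
  mdist (u n) x @[n --> \oo] --> 0 -> mean_dist (u n) @[n --> \oo] --> mean_dist x.
Proof. by apply: cvg_dominated_dist => n; exact: mean_dist_lipschitz. Qed.

Lemma cvg_cdist (u v : nat -> X) (x y : X) :
  mdist (u n) x @[n --> \oo] --> 0 -> mdist (v n) y @[n --> \oo] --> 0 ->
  cdist (u n) (v n) @[n --> \oo] --> cdist x y.
Proof.
move=> ux vy; apply: cvgD; last exact: cvg_cst.
by apply: cvgB; [apply: cvgB|]; [exact: cvg_mdist|exact: cvg_mean_dist..].
Qed.

Lemma cvg_mdist_cst (y : X) : mdist y y @[n --> \oo] --> (0 : R).
Proof. by rewrite mdistxx; exact: cvg_cst. Qed.

Lemma dist_mean_measure :
  dist_mean (charge_of_finite_measure mu) = mean_dist.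
Proof. by apply/funext => x; rewrite /dist_mean charge_integral_measure//; exact: L1_mdist. Qed.

Lemma centered_dist_measure :
  centered_dist (charge_of_finite_measure mu) = cdist.
Proof.
apply/funext => x; apply/funext => y.
rewrite /centered_dist /dist_energy dist_mean_measure charge_integral_measure//.
exact: L1_mean_dist.
Qed.

(** Up to sign, [cdist] is the kernel [k] of [negative_type_psd] centered at [mu]:
    its form at [a] is the form of [k] at the point masses [a] minus their total
    mass times [mu]. *)
Lemma cdist_psd : separable X -> negative_type X -> psd (fun x y => - cdist x y).
Proof.
move=> sepX negX; split=> [x y|I x a]; first by rewrite cdist_sym.
have [p [q [fq qo qc]]] := separable_approximation sepX.
pose k (x y : X) : R := mdist x p + mdist y p - mdist x y.
have k0 u v : 0 <= k u v.
  by rewrite /k subr_ge0 (metric_sym v p); exact: metric_triangle.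
have kl u v : `|k u v| <= 2 * mdist u p.
  rewrite ger0_norm// /k; have := metric_triangle v u p.
  by rewrite (metric_sym v u); lra.
have kr u v : `|k u v| <= 2 * mdist v p.
  rewrite ger0_norm// /k; have := metric_triangle u v p; lra.
have mdo : measurable_fun (setT : set (borel X)) (fun u : borel X => mdist (u : X) p : R).
  by under eq_fun do rewrite metric_sym; exact: measurable_mdistl.
have dL : L1 mu (fun u : borel X => mdist (u : X) p).
  by under eq_fun do rewrite metric_sym; exact: L1_mdist.
have mk : measurable_fun (setT : set (borel X * borel X)) (fun w => k w.1 w.2).
  apply: measurable_funB; last exact: measurable_mdist.
  apply: measurable_funD.
    exact: measurableT_comp mdo measurable_fst.
  exact: measurableT_comp mdo measurable_snd.
have ck (u v : nat -> X) (u' v' : X) : mdist (u n) u' @[n --> \oo] --> (0 : R) ->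
    mdist (v n) v' @[n --> \oo] --> (0 : R) -> k (u n) (v n) @[n --> \oo] --> k u' v'.
  move=> uu vv; apply: cvgB; [apply: cvgD|];
    by apply: cvg_mdist => //; exact: cvg_mdist_cst.
have dqL : L1 (mu \x mu)%E (fun w : borel X * borel X => 4 * mdist (w.1 : X) p).
  by apply: L1_fst (fun u : borel X => 4 * mdist (u : X) p) _; exact: L1Zl.
have := @psd_integral _ (borel X) R mu k q (fun v _ => 2 * mdist v p)
  (fun w => 4 * mdist (w.1 : X) p) (negative_type_psd p negX) mk fq.
move=> /(_ _ _ _ _ _ dqL I x a (- \sum_i a i)) h.
have {h} : 0 <= \sum_i \sum_j a i * a j * k (x i) (x j) +
    2 * - (\sum_i a i) * (\sum_i a i * \int[mu]_u k u (x i)) +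
    (- \sum_i a i) ^+ 2 * \int[(mu \x mu)%E]_w k w.1 w.2.
  apply: h => [u v|u v|n u v|v|n w].
  - exact: ck (qc u) (cvg_mdist_cst v).
  - exact: ck (qc u) (qc v).
  - exact: kr.
  - exact: L1_cst.
  - apply: le_trans (kl _ _) _.
    have := metric_triangle (q n w.1) w.1 p; have := qo n w.1; lra.
have kE v : \int[mu]_u k u v = mean_dist p + mdist v p - mean_dist v.
  have dvL : L1 mu (fun u : borel X => mdist (u : X) v).
    by under eq_fun do rewrite metric_sym; exact: L1_mdist.
  rewrite /k RintegralB//; last exact: (L1D dL (L1_cst _)).
  rewrite RintegralD//; last exact: L1_cst.
  by rewrite Rint_cst; congr (_ + _ - _); apply: eq_Rintegral => u _; exact: metric_sym.
have kkE : \int[(mu \x mu)%E]_w k w.1 w.2 = 2 * mean_dist p - mean_mean_dist.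
  have kL : L1 (mu \x mu)%E (fun w : borel X * borel X => k w.1 w.2).
    apply: (L1_le _ (fun w : borel X * borel X => 2 * mdist (w.1 : X) p)) mk _ _.
      by move=> w; exact: kl.
    by apply: L1_fst (fun u : borel X => 2 * mdist (u : X) p) _; exact: L1Zl.
  rewrite Rintegral_fubini//=; last first.
    move=> u; apply: (L1_bounded _ _ (2 * mdist u p)) => //.
    exact: (measurableT_comp mk (measurable_pair1 u)).
  transitivity (\int[mu]_u (mean_dist p + mdist (u : X) p - mean_dist u)).
    apply: eq_Rintegral => u _; rewrite -kE; apply: eq_Rintegral => v _.
    by rewrite /k (metric_sym u v); ring.
  rewrite RintegralB//; [|exact: (L1D (L1_cst _) dL)|exact: L1_mean_dist].
  rewrite RintegralD//; last exact: L1_cst.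
  rewrite Rint_cst -/mean_mean_dist; congr (_ - _).
  by rewrite mulr_natl mulr2n; congr (_ + _); apply: eq_Rintegral => u _; exact: metric_sym.
(* it remains to expand both sides in the row sums [S * m f] *)
rewrite kkE; under [X in _ <= _ + _ * X + _]eq_bigr do rewrite kE.
congr (_ <= _).
set S := \sum_i a i; pose m f := \sum_i a i * f (x i).
have rowE f : \sum_i \sum_j a i * a j * f (x i) = S * m f.
  rewrite /m big_distrr/=; apply: eq_bigr => i _.
  by rewrite /S big_distrl; apply: eq_bigr => j _ /=; rewrite mulrAC mulrC mulrA.
have colE f : \sum_i \sum_j a i * a j * f (x j) = S * m f.
  rewrite exchange_big -rowE; apply: eq_bigr => i _; apply: eq_bigr => j _.
  by rewrite (mulrC (a j)).
pose Q := \sum_i \sum_j a i * a j * mdist (x i) (x j).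
have split3 (f g : X -> R) (h : I -> I -> R) :
    \sum_i \sum_j a i * a j * (f (x i) + g (x j) + h i j) =
    S * m f + S * m g + \sum_i \sum_j a i * a j * h i j.
  rewrite -rowE -colE -!big_split/=; apply: eq_bigr => i _.
  by rewrite -!big_split/=; apply: eq_bigr => j _; ring.
have mD (c : R) (f : X -> R) : m (fun u => c + f u) = c * S + m f.
  by rewrite /m /S big_distrr -big_split; apply: eq_bigr => i _ /=; ring.
have -> : \sum_i \sum_j a i * a j * k (x i) (x j) =
    S * m (fun u => mdist u p) + S * m (fun u => mdist u p) - Q.
  apply: etrans (split3 (fun u => mdist u p) (fun u => mdist u p)
    (fun i j => - mdist (x i) (x j))) _.
  congr (_ + _); rewrite /Q -sumrN; apply: eq_bigr => i _.
  by rewrite -sumrN; apply: eq_bigr => j _; ring.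
have -> : \sum_i \sum_j a i * a j * - cdist (x i) (x j) =
    S * m mean_dist + S * m (fun u => mean_dist u - mean_mean_dist) - Q.
  rewrite -rowE -colE /Q -big_split -sumrB; apply: eq_bigr => i _.
  rewrite -big_split -sumrB; apply: eq_bigr => j _ /=; rewrite /cdist; ring.
have -> : \sum_i a i * (mean_dist p + mdist (x i) p - mean_dist (x i)) =
    mean_dist p * S + m (fun u => mdist u p) - m mean_dist.
  by rewrite -mD /m -sumrB; apply: eq_bigr => i _; ring.
have -> : m (fun u => mean_dist u - mean_mean_dist) = - mean_mean_dist * S + m mean_dist.
  by rewrite -mD /m; apply: eq_bigr => i _; ring.
ring.
Qed.

End centered_distance.

(** * Strong negative type and changes of density *)

Section density.
Context {d} {T : measurableType d} {R : realType}.

(** The density is recovered as the Radon-Nikodym derivative of the law that it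
    defines. *)
Lemma density_probability (P : probability T R) (F : T -> R) :
  measurable_fun setT F -> (forall u, 0 <= F u) -> (\int[P]_u (F u)%:E = 1)%E ->
  exists Q : probability T R, forall f : T -> R,
    measurable_fun setT f -> (forall u, 0 <= f u) ->
    (\int[Q]_u (f u)%:E = \int[P]_u (f u * F u)%:E)%E.
Proof.
move=> mF F0 F1.
have iF : P.-integrable setT (EFin \o F).
  apply/integrableP; split; first exact/measurable_EFinP.
  by under eq_integral do rewrite /= ger0_norm//; rewrite F1 ltry.
pose nu : {charge set T -> \bar R} := induced_charge iF.
have nu0 A : (0 <= nu A)%E by apply: integral_ge0 => u _; rewrite lee_fin.
pose m : {measure set T -> \bar R} := measure_of_charge nu nu0.
pose mQ := Measure_isProbability.Build _ _ _ m F1.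
pose Q : probability T R := HB.pack (Measure.sort m) mQ (Measure.class m).
exists Q => f mf f0.
have QE A : Q A = (\int[P]_(u in A) (F u)%:E)%E by [].
have QP : Q `<< P.
  apply/null_content_dominatesP => A mA PA; rewrite QE.
  by apply: null_set_integral => //; apply: measurable_funTS; exact/measurable_EFinP.
have mRN := measurable_int _ (Radon_Nikodym_SigmaFinite.f_integrable QP).
rewrite -(Radon_Nikodym_SigmaFinite.change_of_variables QP)//; last first.
  exact/measurable_EFinP.
apply: ae_eq_integral => //.
- by apply: emeasurable_funM => //; exact/measurable_EFinP.
- by apply/measurable_EFinP; exact: measurable_funM.
- under [X in ae_eq _ _ _ X]eq_fun do rewrite EFinM.
  apply: ae_eqe_mul2l; apply: integral_ae_eq => //.
  + exact: Radon_Nikodym_SigmaFinite.f_integrable.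
  + exact/measurable_EFinP.
  + by move=> A _ mA; rewrite -Radon_Nikodym_SigmaFinite.f_integral.
Qed.

End density.

Section strong_negative_type_tilt.
Context {R : realType} {X : pointedMetricType R}.
Context {d} {Z : measurableType d} (P : probability Z R).
Variable phi : {mfun Z >-> borel X}.

(** The function x |-> integral of d(x, .) against mu1 - mu2 is constant, so its
    integral against mu1 - mu2, which is the energy, vanishes. *)
Lemma strong_negative_type_const_mean (mu1 mu2 : probability (borel X) R) (C : R) :
  strong_negative_type X ->
  finite_first_moment mu1 -> finite_first_moment mu2 ->
  (forall x, mean_dist mu1 x = mean_dist mu2 x + C) -> measure_eq mu1 mu2.
Proof.
move=> [_ snX] m1 m2 meanE; apply/(snX mu1 mu2 m1 m2).
rewrite /dist_energy (_ : dist_mean _ = cst C).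
  rewrite charge_integral_measure_sub; [|exact: L1_cst..].
  by rewrite !Rint_cst subrr.
apply/funext => x; rewrite /dist_mean charge_integral_measure_sub//; [|exact: L1_mdist..].
by rewrite -!/(mean_dist _ x) meanE addrC addKr.
Qed.

(** The definition of strong negative type compares probability measures. To
    reach the image under [phi] of the signed measure [h P], compare the law of
    [phi] with its law under the density [1 + e h], where [e] is so small that
    this density is nonnegative. *)
Lemma strong_negative_type_tilt (h : Z -> R) (c C : R) :
  strong_negative_type X -> finite_first_moment (distribution P phi) ->
  measurable_fun setT h -> (forall z, `|h z| <= c) -> \int[P]_z h z = 0 ->
  (forall x : X, \int[P]_z (h z * mdist x (phi z : X)) = C) ->
  forall B, measurable B -> \int[P]_z (h z * \1_B (phi z)) = 0.
Proof.
move=> snX phi1 mh hc h0 hC B mB.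
have c0 : 0 <= c := le_trans (normr_ge0 _) (hc point).
pose e := (c + 1)^-1.
have e0 : 0 < e by rewrite invr_gt0 ltr_wpDl.
have ec z : `|e * h z| <= 1.
  rewrite normrM gtr0_norm// mulrC ler_pdivrMr ?ltr_wpDl// mul1r.
  by rewrite (le_trans (hc z))// lerDl.
pose F z := 1 + e * h z.
have F0 z : 0 <= F z by rewrite /F; have := ec z; rewrite ler_norml; lra.
have mF : measurable_fun setT F.
  by apply: measurable_funD => //; exact: measurable_funM.
have hfL (f : Z -> R) : L1 P f -> L1 P (fun z => h z * f z).
  move=> fL; apply: (L1_le _ (fun z => c * `|f z|)).
  - exact: measurable_funM mh (L1_measurable fL).
  - by move=> z; rewrite normrM ler_wpM2r.
  - by apply: L1Zl; exact: integrable_norm.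
have fFE (f : Z -> R) : L1 P f ->
    \int[P]_z (f z * F z) = \int[P]_z f z + e * \int[P]_z (h z * f z).
  move=> fL; rewrite -RintegralZl//; last exact: hfL.
  rewrite -RintegralD//; last exact: L1Zl (hfL f fL).
  by apply: eq_Rintegral => z _; rewrite /F; ring.
have fFL (f : Z -> R) : L1 P f -> L1 P (fun z => f z * F z).
  move=> fL; apply: eq_integrable (L1D fL (L1Zl e (hfL f fL))) => // z _ /=.
  by congr EFin; rewrite /F; ring.
have F1 : (\int[P]_z (F z)%:E = 1)%E.
  have L1one : L1 P (cst 1) := finite_measure_integrable_cst _ _ measurableT.
  rewrite -[LHS]fineK; last first.
    have := fFL _ L1one; under [in X in _ -> X]eq_integral do rewrite -[F _]mul1r.
    exact: integrable_fin_num.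
  rewrite (_ : fine _ = \int[P]_z (cst 1 z * F z)); last first.
    by congr fine; apply: eq_integral => z _; rewrite mul1r.
  rewrite fFE// Rint_cst; under eq_Rintegral do rewrite mulr1.
  by rewrite h0 mulr0 addr0.
have [Q QE] := density_probability P F mF F0 F1.
have QphiE (f : borel X -> R) : measurable_fun setT f -> (forall x, 0 <= f x) ->
    (\int[distribution Q phi]_x (f x)%:E = \int[P]_z (f (phi z) * F z)%:E)%E.
  move=> mf f0; rewrite ge0_integral_distribution//; last exact/measurable_EFinP.
  by rewrite /comp QE//; exact: measurableT_comp mf (measurable_funPT phi).
have PphiE (f : borel X -> R) : measurable_fun setT f -> (forall x, 0 <= f x) ->
    (\int[distribution P phi]_x (f x)%:E = \int[P]_z (f (phi z))%:E)%E.
  by move=> mf f0; rewrite ge0_integral_distribution//; exact/measurable_EFinP.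
have dL (x : X) : L1 P (fun z => mdist x (phi z : X)).
  have := L1_mdist _ phi1 x => /integrableP[_].
  under eq_integral do rewrite /= ger0_norm ?mdist_ge0//.
  rewrite PphiE//; [|exact: measurable_mdistl|by move=> y; exact: mdist_ge0].
  move=> fin; apply/integrableP; split.
    apply/measurable_EFinP; exact: measurableT_comp (measurable_mdistl x) (measurable_funPT phi).
  by under eq_integral do rewrite /= ger0_norm ?mdist_ge0//.
have Q1 : finite_first_moment (distribution Q phi).
  exists point; under eq_integral do rewrite metric_sym.
  rewrite QphiE//; [|exact: measurable_mdistl|by move=> y; exact: mdist_ge0].
  have := integrable_fin_num measurableT (fFL _ (dL point)).
  by rewrite fin_numElt => /andP[].
have meanE (x : X) : mean_dist (distribution Q phi) x =
    mean_dist (distribution P phi) x + e * C.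
  have mdx := measurable_mdistl x.
  have dx0 (y : borel X) : 0 <= mdist x (y : X) :> R by exact: mdist_ge0.
  by rewrite /mean_dist /Rintegral QphiE// PphiE// -(hC x) -fFE.
have QB := strong_negative_type_const_mean _ _ _ snX Q1 phi1 meanE B mB.
have mIB : measurable_fun setT (\1_B : borel X -> R) by exact: measurable_indic.
have IB0 (x : borel X) : 0 <= \1_B x :> R by [].
have {QB} : (\int[distribution Q phi]_x (\1_B x : R)%:E =
    \int[distribution P phi]_x (\1_B x : R)%:E)%E.
  by rewrite !integral_indic// !setIT; exact: QB.
rewrite QphiE// PphiE// => /(congr1 fine).
have IL : L1 P (fun z => \1_B (phi z) : R).
  apply: (L1_bounded _ _ 1); first exact: measurableT_comp mIB (measurable_funPT phi).
  by move=> z; rewrite ger0_norm// indicE lern1 leq_b1.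
rewrite -[X in X = _]/(\int[P]_z (\1_B (phi z) * F z)) fFE//.
rewrite -[X in _ = X]/(\int[P]_z (\1_B (phi z))) -[X in _ = X]addr0 => /addrI.
by move/eqP; rewrite mulf_eq0 gt_eqF//= => /eqP.
Qed.

End strong_negative_type_tilt.

Section tilt_cdist.
Context {R : realType} {X : pointedMetricType R}.
Context {d} {Z : measurableType d} (P : probability Z R).
Variable phi : {mfun Z >-> borel X}.

(** Since [h] has integral 0, the terms of [cdist] that depend on [x] alone drop
    out, and what remains says that [h (mdist x \o phi)] has the same integral for
    all [x]. *)
Lemma strong_negative_type_cdist (h : Z -> R) (c : R) :
  strong_negative_type X -> finite_first_moment (distribution P phi) ->
  measurable_fun setT h -> (forall z, `|h z| <= c) -> \int[P]_z h z = 0 ->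
  (forall x : X, \int[P]_z (h z * cdist (distribution P phi) (phi z) x) = 0) ->
  forall B, measurable B -> \int[P]_z (h z * \1_B (phi z)) = 0.
Proof.
move=> snX phi1 mh hc h0 hX.
set mu := distribution P phi in phi1 hX.
have hL : L1 P h := L1_bounded P h c mh hc.
have hfL (f : Z -> R) : L1 P f -> L1 P (fun z => h z * f z).
  move=> fL; apply: (L1_le _ (fun z => c * `|f z|)).
  - exact: measurable_funM mh (L1_measurable fL).
  - by move=> z; rewrite normrM ler_wpM2r.
  - by apply: L1Zl; exact: integrable_norm.
have aL := hfL _ (L1_distribution P phi _ (L1_mean_dist mu phi1)).
apply: (strong_negative_type_tilt P phi h c
  (\int[P]_z (h z * mean_dist mu (phi z)))) => // x.
have cL := hfL _ (L1_distribution P phi _ (L1_cdist mu phi1 x)).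
have -> : \int[P]_z (h z * mdist x (phi z : X)) =
    \int[P]_z (h z * cdist mu (phi z) x + h z * mean_dist mu (phi z) +
               (mean_dist mu x - mean_mean_dist mu) * h z).
  by apply: eq_Rintegral => z _; rewrite /cdist (metric_sym x); ring.
rewrite RintegralD//; [|exact: L1D|exact: L1Zl].
by rewrite RintegralD// RintegralZl// hX h0 mulr0 add0r addr0.
Qed.

End tilt_cdist.

Section distance_covariance.
Context {R : realType} {X Y : pointedMetricType R}.
Variable theta : probability (borel X * borel Y)%type R.
Hypotheses (sepX : separable X) (sepY : separable Y).
Hypothesis theta1 : finite_first_moments theta.
Let mu := marginal1 theta.
Let nu := marginal2 theta.
Let mu1 : finite_first_moment mu := theta1.1.
Let nu1 : finite_first_moment nu := theta1.2.

Let k (w w' : X * Y) : R := cdist mu w.1 w'.1 * cdist nu w.2 w'.2.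

Let mk : measurable_fun
  (setT : set ((borel X * borel Y) * (borel X * borel Y))) (fun w => k w.1 w.2).
Proof.
apply: measurable_funM.
  apply: (measurableT_comp (measurable_cdist mu mu1 sepX)
    (g := fun w : (borel X * borel Y) * (borel X * borel Y) => (w.1.1, w.2.1))).
  by apply: measurable_fun_pair; exact: measurableT_comp.
apply: (measurableT_comp (measurable_cdist nu nu1 sepY)
  (g := fun w : (borel X * borel Y) * (borel X * borel Y) => (w.1.2, w.2.2))).
by apply: measurable_fun_pair; exact: measurableT_comp.
Qed.

Let L1_mu (f : borel X -> R) : L1 mu f -> L1 theta (fun w => f w.1).
Proof. exact: L1_distribution. Qed.

Let L1_nu (f : borel Y -> R) : L1 nu f -> L1 theta (fun w => f w.2).
Proof. exact: L1_distribution. Qed.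

Lemma dcovE : dcov theta = \int[(theta \x theta)%E]_w k w.1 w.2.
Proof. by rewrite /dcov !centered_dist_measure. Qed.

Let k_bound (u v : X * Y) : `|k u v| <= 2 * mean_dist mu u.1 * (2 * mean_dist nu v.2).
Proof. by rewrite normrM ler_pM// ?cdist_boundl ?cdist_boundr. Qed.

(** Cauchy-Schwarz for the form of k, in the shape: a nonnegative quadratic
    polynomial in [t] without constant term has no linear term. *)
Lemma dcov0_kernel : negative_type X -> negative_type Y -> dcov theta = 0 ->
  forall v : X * Y, \int[theta]_w k w v = 0.
Proof.
move=> negX negY; rewrite dcovE => k0 v.
have [p [qX [fqX qXp qXc]]] := separable_approximation sepX.
have [p' [qY [fqY qYp qYc]]] := separable_approximation sepY.
have kp : psd k.
  have := schur_product _ _ _ (psd_comp (fst : X * Y -> X) (cdist_psd mu mu1 sepX negX))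
    (psd_comp (snd : X * Y -> Y) (cdist_psd nu nu1 sepY negY)).
  congr psd; apply/funext => w; apply/funext => w'; exact: mulrNN.
pose q n (w : borel X * borel Y) : borel X * borel Y := (qX n w.1, qY n w.2).
pose g (w : (borel X * borel Y) * (borel X * borel Y)) : R :=
  2 * (mean_dist mu w.1.1 + mdist p (w.1.1 : X)) *
  (2 * (mean_dist nu w.2.2 + mdist p' (w.2.2 : Y))).
have gL : L1 (theta \x theta)%E g.
  apply: (L1_prod _ _ (fun w : borel X * borel Y => 2 * (mean_dist mu w.1 + mdist p (w.1 : X)))
    (fun w : borel X * borel Y => 2 * (mean_dist nu w.2 + mdist p' (w.2 : Y)))).
    by apply/L1Zl/L1D; apply: L1_mu; [exact: L1_mean_dist|exact: L1_mdist].
  by apply/L1Zl/L1D; apply: L1_nu; [exact: L1_mean_dist|exact: L1_mdist].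
apply: (@ge0_quadratic_slope0 _ _ (k v v / 2)) => t.
have := @psd_integral _ _ R theta k q
  (fun v _ => 2 * mean_dist mu v.1 * (2 * mean_dist nu v.2)) g kp mk.
have fq n : finite_range (q n) by exact: finite_range_pair.
move=> /(_ fq _ _ _ _ _ gL 'I_1 (fun=> v) (fun=> t) 1) h.
have {h} : 0 <= t * t * k v v + 2 * (t * \int[theta]_w k w v).
  rewrite !big_ord1 mulr1 expr1n mul1r k0 addr0 in h; apply: h.
  - move=> w u; apply: cvgM.
      exact: (cvg_cdist mu mu1 _ _ _ _ (qXc w.1) (cvg_mdist_cst u.1)).
    exact: (cvg_cdist nu nu1 _ _ _ _ (qYc w.2) (cvg_mdist_cst u.2)).
  - move=> w u; apply: cvgM.
      exact: (cvg_cdist mu mu1 _ _ _ _ (qXc w.1) (qXc u.1)).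
    exact: (cvg_cdist nu nu1 _ _ _ _ (qYc w.2) (qYc u.2)).
  - by move=> n w u; rewrite normrM ler_pM// cdist_boundr.
  - by move=> u; exact: L1_cst.
  - move=> n w; apply: le_trans (k_bound _ _) _.
    have h1 := mean_dist_le mu mu1 (qX n w.1.1) w.1.1.
    have h2 := mean_dist_le nu nu1 (qY n w.2.2) w.2.2.
    have h3 := qXp n w.1.1; have h4 := qYp n w.2.2.
    apply: ler_pM; rewrite ?mulr_ge0 ?mean_dist_ge0//.
      by rewrite (metric_sym p); lra.
    by rewrite (metric_sym p'); lra.
lra.
Qed.

Lemma independent_of_kernel : strong_negative_type X -> strong_negative_type Y ->
  (forall v : X * Y, \int[theta]_w k w v = 0) ->
  measure_eq theta (mu \x nu)%E.
Proof.
move=> snX snY k0.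
have muL (B : set (borel X)) : measurable B -> L1 mu (\1_B : borel X -> R).
  by move=> mB; exact: integrable_indic.
have nuL (C : set (borel Y)) : measurable C -> L1 nu (\1_C : borel Y -> R).
  by move=> mC; exact: integrable_indic.
have muE (B : set (borel X)) : measurable B ->
    \int[theta]_w \1_B w.1 = fine (mu B).
  move=> mB; rewrite -(Rintegral_distribution theta _ _ (muL B mB)).
  by rewrite /Rintegral integral_indic// setIT.
have nuE (C : set (borel Y)) : measurable C ->
    \int[theta]_w \1_C w.2 = fine (nu C).
  move=> mC; rewrite -(Rintegral_distribution theta _ _ (nuL C mC)).
  by rewrite /Rintegral integral_indic// setIT.
have cE y : \int[theta]_w cdist nu w.2 y = 0.
  by rewrite -(Rintegral_distribution theta _ _ (L1_cdist nu nu1 y)) Rintegral_cdist.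
have cL y : L1 theta (fun w => cdist nu w.2 y) by exact: (L1_nu _ (L1_cdist nu nu1 y)).
(* c_nu(., y) is bounded, so it can serve as the density [h] on the X side *)
have step1 (y : Y) (B : set (borel X)) : measurable B ->
    \int[theta]_w (cdist nu w.2 y * \1_B w.1) = 0.
  apply: (strong_negative_type_cdist theta _ _ (2 * mean_dist nu y) snX mu1) => //.
  - exact: L1_measurable (cL y).
  - by move=> w; exact: cdist_boundr.
  - by move=> x; rewrite -[RHS](k0 (x, y)); apply: eq_Rintegral => w _; rewrite mulrC.
(* with density 1_B - mu(B), the hypothesis on [cdist nu] comes from [step1] *)
have step2 (B : set (borel X)) (C : set (borel Y)) : measurable B -> measurable C ->
    \int[theta]_w ((\1_B w.1 - fine (mu B)) * \1_C w.2) = 0.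
  move=> mB.
  apply: (strong_negative_type_cdist theta _ _ (1 + fine (mu B)) snY nu1).
  - exact: L1_measurable (L1B (L1_mu _ (muL B mB)) (L1_cst _)).
  - move=> w; apply: le_trans (ler_normB _ _) _.
    by rewrite lerD// ger0_norm ?fine_ge0// indicE lern1 leq_b1.
  - rewrite RintegralB//; [|exact: L1_mu _ (muL B mB)|exact: L1_cst].
    by rewrite muE// Rint_cst subrr.
  - move=> y; transitivity (\int[theta]_w (cdist nu w.2 y * \1_B w.1 -
      fine (mu B) * cdist nu w.2 y)).
      by apply: eq_Rintegral => w _; rewrite mulrBl mulrC.
    rewrite RintegralB//; last exact: L1Zl.
      by rewrite step1// RintegralZl// cE mulr0 subr0.
    apply: (L1_le _ (fun=> 2 * mean_dist nu y)); last exact: L1_cst.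
      apply: measurable_funM; first exact: L1_measurable (cL y).
      exact: L1_measurable (L1_mu _ (muL B mB)).
    move=> w; rewrite normrM -[leRHS]mulr1 ler_pM ?cdist_boundr//.
    by rewrite ger0_norm// indicE lern1 leq_b1.
move=> A mA; apply/esym; apply: product_measure_unique => // B C mB mC.
have BCE w : \1_(B `*` C) w = \1_B w.1 * \1_C w.2 :> R.
  by rewrite !indicE in_setX -natrM mulnb.
have BCL : L1 theta (\1_(B `*` C) : borel X * borel Y -> R).
  by apply: integrable_indic; exact: measurableX.
have := step2 B C mB mC.
have -> : \int[theta]_w ((\1_B w.1 - fine (mu B)) * \1_C w.2) =
    \int[theta]_w (\1_(B `*` C) w - fine (mu B) * \1_C w.2).
  by apply: eq_Rintegral => w _; rewrite BCE mulrBl.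
rewrite RintegralB//; last exact/L1Zl/L1_nu/nuL.
rewrite RintegralZl//; last exact/L1_nu/nuL.
rewrite nuE// {1}/Rintegral integral_indic ?setIT//; last exact: measurableX.
move/eqP; rewrite subr_eq0 => /eqP BC.
rewrite -[LHS]fineK ?fin_num_measure ?BC//; last exact: measurableX.
by rewrite EFinM !fineK ?fin_num_measure.
Qed.

(** Under independence the inner integral of k factors, and each factor vanishes
    because [cdist] is centered. *)
Lemma dcov_independent : measure_eq theta (mu \x nu)%E -> dcov theta = 0.
Proof.
move=> thetaE; rewrite dcovE Rintegral_fubini/=.
- rewrite (_ : (fun _ => _) = cst 0); first by rewrite Rint_cst.
  apply/funext => w.
  transitivity (\int[(mu \x nu)%E]_w' (cdist mu w'.1 w.1 * cdist nu w'.2 w.2)).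
    transitivity (\int[(mu \x nu)%E]_w' k w w').
      by congr fine; apply: eq_measure_integral => A mA _; exact: thetaE.
    by apply: eq_Rintegral => w' _; rewrite /k (cdist_sym mu) (cdist_sym nu).
  rewrite (Rintegral_prod _ _ (fun x : borel X => cdist mu x w.1)
    (fun y : borel Y => cdist nu y w.2)).
  + by rewrite Rintegral_cdist// mul0r.
  + exact: L1_cdist.
  + exact: L1_cdist.
- apply: (L1_le _ (fun w : (borel X * borel Y) * (borel X * borel Y) =>
    2 * mean_dist mu w.1.1 * (2 * mean_dist nu w.2.2)) mk).
  + by move=> w; exact: k_bound.
  + apply: (L1_prod _ _ (fun w : borel X * borel Y => 2 * mean_dist mu w.1)
    (fun w : borel X * borel Y => 2 * mean_dist nu w.2)).
      by apply/L1Zl/L1_mu; exact: L1_mean_dist.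
    by apply/L1Zl/L1_nu; exact: L1_mean_dist.
- move=> w; apply: (L1_le _ (fun w' : borel X * borel Y =>
    2 * mean_dist mu w.1 * (2 * mean_dist nu w'.2))).
  + exact: (measurableT_comp mk (measurable_pair1 w)).
  + by move=> w'; exact: k_bound.
  + by apply/L1Zl/L1Zl/L1_nu; exact: L1_mean_dist.
Qed.

End distance_covariance.

Theorem theorem3p24 (R : realType) (X Y : pointedMetricType R)
  (sepX : separable X) (sepY : separable Y)
  (negX : strong_negative_type X) (negY : strong_negative_type Y)
  (theta : probability (borel X * borel Y)%type R)
  (theta1 : finite_first_moments theta) :
  dcov theta = 0 <->
  measure_eq theta (marginal1 theta \x marginal2 theta)%E.
Proof.
split=> [dcov0|]; last exact: dcov_independent.
apply: independent_of_kernel => //.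
by apply: dcov0_kernel => //; [exact: negX.1|exact: negY.1].
Qed.
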